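(* Fix integers $k_1\ge 0$ and $i\ge 1$. Then there exists $k_0=k_0(i,k_1)\in\mathbb{N}$ such that the following holds. Fix a tensor $T_0$ and positive constants $C_*$, $C$ and $(C_k)_{k\ge 0}$. There are constants $\Lambda$, $C'$ and $(C_{k,*})_{0\le k\le k_1}$, depending only on $i,k_1,T_0,C_*,C,(C_k)_k$ (in particular not on $\lambda,\ell$ nor on the maps and tensors below), such that the following is true for all $\lambda,\ell>0$ with $\lambda\ell\ge\Lambda$. For $1\le j\le i+1$ let $b^j$ be a bilinear map from pairs of vectors to tensors, with inverse $F^j$ defined on the $3C_*^{-1}$-neighbourhood of $T_0$ (so $b^j(F^j(S),F^j(S))=S$ there). Assume that for all tensors $S,S'$ in the $3C_*^{-1}$-neighbourhood of $T_0$ and all $0\le k\le k_0+1$, $$\|F^j(S)\|_k\le C_*\Big(\|S\|_k+\frac{\lambda^k}{\lambda\ell}\Big)\qquad(1\le j\le i+1),$$ $$\|F^{j+1}(S)-F^j(S')\|_k\le C_*\Big(\|S-S'\|_k+\frac{\lambda^k}{(\lambda\ell)^j}+(\|S'\|_k+\lambda^k)\Big(\|S-S'\|_0+\frac1{(\lambda\ell)^j}\Big)\Big)\qquad(1\le j\le i).$$ Let $T$ be a tensor in the $(3C_* )^{-1}$-neighbourhood of $T_0$ with $\|T\|_k\le C\frac{\lambda^k}{\lambda\ell}$ for every $k\ge1$. Put $a^{(0)}=0$, $a^{(1)}=F^1(T)$ and, recursively for $1\le j\le i$, whenever $T-r^j(a^{(j)})$ lies in the $3C_*^{-1}$-neighbourhood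 of $T_0$, $$a^{(j+1)}=F^{j+1}\big(T-r^j(a^{(j)})\big),$$ where $r^1,\dots,r^{i+1}$ are admissible maps (see context) with constants $(C_k)_k$; $r^j$ is allowed to depend on the previous steps, i.e. on $a^{(0)},\dots,a^{(j)}$ and $r^1,\dots,r^{j-1}$. Put $$E_j=T-b^j(a^{(j)},a^{(j)})-r^j(a^{(j)}).$$ Assume that (i) $\|a^{(1)}\|_0\le C$; (ii) $\|a^{(1)}\|_k\le C\frac{\lambda^k}{\lambda\ell}$ for all $1\le k\le k_0-1$; (iii) $\|E_1\|_k\le C\frac{\lambda^k}{\lambda\ell}$ for all $0\le k\le k_0-1$. Assume moreover that, inductively, for each $1\le j\le i$ for which $a^{(1)},\dots,a^{(j+1)}$ are defined by the recursion, the following inequalities hold for all $0\le k\le k_0-j-1$: for the linear part, $$\|r^j_1(a^{(j)})-r^j_1(a^{(j+1)})\|_k+\|r^j_1(a^{(j+1)})-r^{j+1}_1(a^{(j+1)})\|_k\le\frac{C_k\lambda^k}{(\lambda\ell)^{j+1}},$$ and for the bilinear part (denoted $r^j(\cdot,\cdot)$), $$\|r^{j+1}(a^{(j+1)},a^{(j+1)})-r^j(a^{(j+1)},a^{(j+1)})\|_k\le\frac{C_k\lambda^k}{(\lambda\ell)^{j+1}},$$ $$\|r^j(a^{(j+1)},a^{(j+1)}-a^{(j)})\|_k+\|r^j(a^{(j)}-a^{(j+1)},a^{(j)})\|_k\le\frac{C_k\lambda^k}{(\lambda\ell)^{j+1}}.$$ Then the recursion is well defined up to $a^{(i+1)}$,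 and $a^{(i+1)}$ and $r^{i+1}$ satisfy: (1) $\|a^{(i+1)}\|_0\le C'$; (2) $\|a^{(i+1)}\|_k\le C'\frac{\lambda^k}{\lambda\ell}$ for all $1\le k\le k_1$; (3) $\|E_{i+1}\|_k\le C'\frac{\lambda^k}{(\lambda\ell)^{i}}$ for all $0\le k\le k_1$; (4) $\|a^{(i+1)}-a^{(i)}\|_k\le C_{k,*}\frac{\lambda^k}{(\lambda\ell)^i}$ for all $0\le k\le k_1$.
   Context: Fix a compact domain or compact manifold. ''Vectors'' $a,b$ are smooth vector-valued functions on it (with a fixed number of components) and ''tensors'' $T,S$ are smooth tensor-valued functions (sections of a fixed tensor bundle); $\|\cdot\|_k$ is the $C^k$ norm, and $\nabla a$ denotes the derivative of $a$. The $\rho$-neighbourhood of $T_0$ is taken in the $C^0$ topology: $\{S:\|S-T_0\|_0<\rho\}$. Maps called bilinear are bilinear maps from pairs of vector-valued functions to tensor-valued functions. An inverse $F$ of a bilinear $b$ is a map assigning to a tensor $S$ a vector $a=F(S)$ with $b(a,a)=S$. Admissible maps: $r$ is a map from vectors to tensors of the form $$r(a)=r_1(a)+r_2(a,a)+r_3(\nabla a,\nabla a)+r_4(a,a),$$ with $r_1$ linear in $a$ and $r_2,r_3,r_4$ bilinear in the pair (so $r(0)=0$; $r_4$ may involve first derivatives of its first argument), such that for all vectors $a,b$ and all $k\ge0$ $$\|r_1(a)\|_k\le\frac{C_k}{\lambda\ell}\sum_{j=0}^k\|a\|_j\lambda^{k-j},$$ $$\|r_2(a,b)\|_k\le\frac{C_k}{\lambda^2\ell^2}\sum_{0\le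 j_1+j_2\le k}\|a\|_{j_1}\|b\|_{j_2}\lambda^{k-j_1-j_2},$$ $$\|r_3(\nabla a,\nabla b)\|_k\le\frac{C_k}{\lambda^2}\sum_{0\le j_1+j_2\le k}\|\nabla a\|_{j_1}\|\nabla b\|_{j_2}\lambda^{k-j_1-j_2},$$ $$\|r_4(a,b)\|_k\le\frac{C_k}{\lambda^2\ell}\sum_{0\le j_1+j_2\le k}\|a\|_{j_1+1}\|b\|_{j_2}\lambda^{k-j_1-j_2}.$$ The linear part of $r$ is $r_1$; the bilinear part of $r$ is $r(a,b):=r_2(a,b)+r_3(\nabla a,\nabla b)+r_4(a,b)$. A superscript $j$ on $r$ and its components $r^j_1,\dots,r^j_4$ indicates the $j$-th map of the sequence. *)

(* Defs.v *)
From HB Require Import structures.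
From mathcomp Require Import all_boot all_order all_algebra.
From mathcomp Require Import all_classical all_reals all_analysis.

Set Implicit Arguments.
Unset Strict Implicit.
Unset Printing Implicit Defensive.

Import Order.TTheory GRing.Theory Num.Theory.
Import numFieldNormedType.Exports.
Local Open Scope classical_set_scope.
Local Open Scope ring_scope.

Section SmoothUpToTheBoundary.
Variables (R : realType) (n : nat).
Implicit Types (f g : 'rV[R]_n -> R^o) (D : set 'rV[R]_n).

Definition partial (i : 'I_n) f : 'rV[R]_n -> R^o :=
  fun x => 'D_(delta_mx 0 i) f x.

(* The iterated partial derivative of order [size s] in the directions listed
   in [s]. *)
Definition partials (s : seq 'I_n) f : 'rV[R]_n -> R^o := foldr partial f s.

(* [f] is smooth on [D], in the sense of C^oo(closure Omega): in the interior
   all partial derivatives of all orders exist, and each of them extends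
   continuously to [D].  Only the values of [f] in the interior matter; the
   sets [D] used below are contained in the closure of their interior, so these
   values determine the continuous extension of [f] to [D]. *)
Definition smooth_on D f : Prop :=
  (forall s i x, D° x -> derivable (partials s f) x (delta_mx 0 i)) /\
  (forall s, exists2 g, {within D, continuous g} &
     forall x, D° x -> partials s f x = g x).

Lemma partials_lin D (c : R) f g : smooth_on D f -> smooth_on D g ->
  forall s x, D° x ->
    partials s (c *: f + g) x = c *: partials s f x + partials s g x.
Proof.
move=> [fd _] [gd _]; elim=> [|i s IHs] x Dx //=.
rewrite /partial.
have -> : 'D_(delta_mx 0 i) (partials s (c *: f + g)) x =
  'D_(delta_mx 0 i) (c *: partials s f + partials s g) x.
  apply: near_eq_derive => //.
  near=> y; apply: IHs.
  by near: y; exact: open_nbhs_nbhs (conj (@open_interior _ D) Dx).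
rewrite deriveD; [|exact/derivableZ/fd|exact: gd].
by rewrite deriveZ; last exact: fd.
Unshelve. all: by end_near. Qed.

Lemma smooth_on_lin D (c : R) f g :
  smooth_on D f -> smooth_on D g -> smooth_on D (c *: f + g).
Proof.
move=> fs gs; split=> [s i x Dx|s].
- apply: (@near_eq_derivable _ _ _ (c *: partials s f + partials s g)) => //.
    near=> y; apply/esym; apply: (partials_lin _ fs gs).
    by near: y; exact: open_nbhs_nbhs (conj (@open_interior _ D) Dx).
  by apply: derivableD; [apply: derivableZ; exact: fs.1|exact: gs.1].
- have [f' f'c ff'] := fs.2 s; have [g' g'c gg'] := gs.2 s.
  exists (c *: f' + g') => [x|x Dx].
    by apply: cvgD; [apply: cvgZl_tmp; exact: f'c|exact: g'c].
  by rewrite (partials_lin _ fs gs)// ff'// gg'.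
Unshelve. all: by end_near. Qed.

Lemma smooth_on0 D : smooth_on D 0.
Proof.
have p0 s : partials s (0 : 'rV[R]_n -> R^o) = 0.
  by elim: s => //= i s ->; apply/funext => x; exact: derive_cst.
split=> [s i x _|s]; first by rewrite p0; exact: derivable_cst.
by exists 0 => [|x _]; [exact: cst_continuous|rewrite p0].
Qed.

End SmoothUpToTheBoundary.

(* A compact manifold or a compact domain, of dimension [mdim], with a fixed
   finite atlas.  The chart [phi c] is a homeomorphism from the open set
   [chart_dom c] onto [chart_img c], with inverse [psi c] (a total function,
   whose values outside [chart_img c] are irrelevant).  The image of a chart
   need only lie in the closure of its interior: it is open for a closed
   manifold, relatively open in a half space for a manifold with boundary, and
   the whole domain, in the single chart given by the inclusion, for a compact
   domain in R^mdim.  The compact sets [chart_core c] shrink the atlas, so that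
   the C^k norms below are finite. *)
Record compact_manifold (R : realType) := CompactManifold {
  carrier :> topologicalType;
  mdim : nat;
  chart : finType;
  chart_dom : chart -> set carrier;
  phi : chart -> carrier -> 'rV[R]_mdim;
  psi : chart -> 'rV[R]_mdim -> carrier;
  chart_core : chart -> set carrier;
  carrier_hausdorff : hausdorff_space carrier;
  carrier_compact : compact [set: carrier];
  chart_dom_open : forall c, open (chart_dom c);
  phi_continuous : forall c, {within chart_dom c, continuous (phi c)};
  psi_continuous :
    forall c, {within phi c @` chart_dom c, continuous (psi c)};
  phiK : forall c q, chart_dom c q -> psi c (phi c q) = q;
  image_regular :
    forall c, phi c @` chart_dom c `<=` closure (phi c @` chart_dom c)°;
  transition_smooth : forall c d i,
    smooth_on (phi c @` (chart_dom c `&` chart_dom d))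
              (fun x => phi d (psi c x) 0 i);
  chart_core_compact : forall c, compact (chart_core c);
  chart_core_sub : forall c, chart_core c `<=` chart_dom c;
  chart_core_cover : [set: carrier] `<=` \bigcup_c (chart_core c)°
}.

Section CkNorm.
Variables (R : realType) (X : compact_manifold R).

Definition chart_img (c : chart X) : set 'rV[R]_(mdim X) :=
  phi c @` chart_dom c.

(* The C^k norm of a field with components [f c j], [j : J], in the chart [c]:
   the supremum of the absolute values of all partial derivatives of order at
   most [k] of all components. *)
Definition Ck_norm (J : finType) (k : nat)
    (f : chart X -> J -> 'rV[R]_(mdim X) -> R^o) : R :=
  sup [set y | exists c j s x,
    [/\ (size s <= k)%N, (phi c @` chart_core c) x, (chart_img c)° x &
        y = `|partials s (f c j) x|]].

End CkNorm.

(* "Vectors": smooth functions with [p] real components. *)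
Section Vectors.
Variables (R : realType) (X : compact_manifold R) (p : nat).

Definition vcomp (a : X -> 'rV[R]_p) :
    chart X -> 'I_p -> 'rV[R]_(mdim X) -> R^o :=
  fun c j x => a (psi c x) 0 j.

Definition smooth_vec : {pred X -> 'rV[R]_p} := fun a =>
  `[< continuous a /\ forall c j, smooth_on (chart_img c) (vcomp a c j) >].

Lemma smooth_vec_submod : submod_closed smooth_vec.
Proof.
split=> [|k a b].
  apply/asboolP; split=> [|c j]; first exact: cst_continuous.
  have -> : vcomp 0 c j = cst 0 by apply/funext => x; rewrite /vcomp mxE.
  exact: smooth_on0.
move=> /asboolP[ac asm] /asboolP[bc bsm]; apply/asboolP; split=> [q|c j].
  by apply: cvgD; [apply: cvgZl_tmp; exact: ac|exact: bc].
have -> : vcomp (k *: a + b) c j = k *: vcomp a c j + vcomp b c j.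
  by apply/funext => x; rewrite /vcomp !mxE.
exact: smooth_on_lin.
Qed.
HB.instance Definition _ :=
  GRing.isSubmodClosed.Build R (X -> 'rV[R]_p) smooth_vec smooth_vec_submod.

Record vec := Vec { vec_fun :> X -> 'rV[R]_p; _ : vec_fun \in smooth_vec }.
HB.instance Definition _ := [isSub for vec_fun].
HB.instance Definition _ := [Choice of vec by <:].
HB.instance Definition _ := [SubChoice_isSubLmodule of vec by <:].

Definition vec_norm (k : nat) (a : vec) : R := Ck_norm k (vcomp a).

End Vectors.

(* The derivative [grad a] of a vector [a], given by its first partial
   derivatives in the charts.  Components of gradients and of tensors are only
   recorded in the interior of the images of the charts, which determines them
   by continuity, and are set to 0 elsewhere, so that equality of fields is
   equality in Rocq. *)
Section Gradients.
Variables (R : realType) (X : compact_manifold R) (p : nat).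

Definition grad_comp (a : vec X p) :
    chart X -> 'I_p * 'I_(mdim X) -> 'rV[R]_(mdim X) -> R^o :=
  fun c ji => partial ji.2 (vcomp a c ji.1) \_ (chart_img c)°.

Definition is_gradient :
    {pred chart X -> 'I_p * 'I_(mdim X) -> 'rV[R]_(mdim X) -> R^o} :=
  fun f => `[< exists a : vec X p, f = grad_comp a >].

Lemma grad_comp_lin (k : R) (a b : vec X p) :
  grad_comp (k *: a + b) = k *: grad_comp a + grad_comp b.
Proof.
apply/funext => c; apply/funext => -[j i]; apply/funext => x.
rewrite /grad_comp /= !fctE /patch /=; case: ifPn => [xD|_]; last first.
  by rewrite scaler0 addr0.
have /asboolP[_ as_] := valP a; have /asboolP[_ bs] := valP b.
have -> : vcomp (k *: a + b : vec X p) c j = k *: vcomp a c j + vcomp b c j.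
  by apply/funext => y; rewrite /vcomp !mxE.
have /= -> // := @partials_lin _ _ _ k _ _ (as_ c j) (bs c j) [:: i] x.
exact: set_mem.
Qed.

Lemma is_gradient_submod : submod_closed is_gradient.
Proof.
split=> [|k f g].
  apply/asboolP; exists 0.
  by have := grad_comp_lin (-1) 0 0; rewrite scaler0 addr0 scaleN1r addNr.
move=> /asboolP[a ->] /asboolP[b ->]; apply/asboolP; exists (k *: a + b).
by rewrite grad_comp_lin.
Qed.
HB.instance Definition _ :=
  GRing.isSubmodClosed.Build R _ is_gradient is_gradient_submod.

Record gradient := Gradient {
  gradient_comp :> chart X -> 'I_p * 'I_(mdim X) -> 'rV[R]_(mdim X) -> R^o;
  _ : gradient_comp \in is_gradient }.
HB.instance Definition _ := [isSub for gradient_comp].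
HB.instance Definition _ := [Choice of gradient by <:].
HB.instance Definition _ := [SubChoice_isSubLmodule of gradient by <:].

Lemma grad_subproof (a : vec X p) : grad_comp a \in is_gradient.
Proof. by apply/asboolP; exists a. Qed.
Definition grad (a : vec X p) : gradient := Gradient (grad_subproof a).

Definition grad_norm (k : nat) (g : gradient) : R := Ck_norm k g.

End Gradients.

(* Tensors with [r] contravariant and [s] covariant indices at a point of an
   [n]-dimensional space, and their transformation law under the change of
   coordinates with Jacobian matrix [A i j = d x^i / d y^j]. *)
Notation tindex n r s := ({ffun 'I_r -> 'I_n} * {ffun 'I_s -> 'I_n})%type.

Definition tensor_act (R : realType) (n r s : nat) (A : 'M[R]_n)
    (w : {ffun tindex n r s -> R^o}) : {ffun tindex n r s -> R^o} :=
  [ffun I : tindex n r s => \sum_(L : tindex n r s)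
     (\prod_(m < r) A (I.1 m) (L.1 m)) *
     (\prod_(m < s) invmx A (L.2 m) (I.2 m)) * w L].

(* A tensor bundle: the tensors of a given type whose components lie in a given
   linear subspace invariant under changes of coordinates (all tensors,
   symmetric tensors, alternating tensors, ...). *)
Record tensor_bundle (R : realType) (n : nat) := TensorBundle {
  contra_rank : nat;
  co_rank : nat;
  fibre : {vspace {ffun tindex n contra_rank co_rank -> R^o}};
  fibre_invariant : forall (A : 'M[R]_n) w,
    A \in unitmx -> w \in fibre -> tensor_act A w \in fibre
}.

(* "Tensors": smooth sections of the tensor bundle [E]. *)
Section Tensors.
Variables (R : realType) (X : compact_manifold R).
Variable E : tensor_bundle R (mdim X).
Local Notation J := (tindex (mdim X) (contra_rank E) (co_rank E)).
Implicit Types S : chart X -> J -> 'rV[R]_(mdim X) -> R^o.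

Definition tensor_at S (c : chart X) (x : 'rV[R]_(mdim X)) : {ffun J -> R^o} :=
  [ffun I => S c I x].

(* The Jacobian matrix at [q] of the coordinates [phi c] with respect to the
   coordinates [phi d]. *)
Definition transition_jacobian (c d : chart X) (q : X) : 'M[R]_(mdim X) :=
  \matrix_(i, j) partial j (fun y => phi c (psi d y) 0 i) (phi d q).

Definition smooth_section : {pred chart X -> J -> 'rV[R]_(mdim X) -> R^o} :=
  fun S => `[< [/\ forall c I, smooth_on (chart_img c) (S c I),
    forall c I x, ~ (chart_img c)° x -> S c I x = 0,
    forall c x, tensor_at S c x \in fibre E &
    forall c d q, chart_dom c q -> chart_dom d q ->
      (chart_img c)° (phi c q) -> (chart_img d)° (phi d q) ->
      tensor_at S c (phi c q) =
        tensor_act (transition_jacobian c d q) (tensor_at S d (phi d q))] >].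

Lemma smooth_section_submod : submod_closed smooth_section.
Proof.
split=> [|k S S'].
  apply/asboolP; split=> [c I|//|c x|c d q *].
  - exact: smooth_on0.
  - have -> : tensor_at 0 c x = 0 by apply/ffunP => I; rewrite !ffunE.
    exact: mem0v.
  - apply/ffunP => I; rewrite !ffunE big1// => L _.
    by rewrite ffunE mulr0.
move=> /asboolP[Ssm S0 SE Str] /asboolP[Ssm' S0' SE' Str'].
have lin c x :
    tensor_at (k *: S + S') c x = k *: tensor_at S c x + tensor_at S' c x.
  by apply/ffunP => I; rewrite !ffunE.
apply/asboolP; split=> [c I|c I x Dx|c x|c d q cq dq cD dD].
- exact: smooth_on_lin.
- have -> : (k *: S + S') c I x = k *: S c I x + S' c I x by [].
  by rewrite S0// S0'// scaler0 addr0.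
- by rewrite lin memvD// memvZ.
- rewrite !lin (Str c d)// (Str' c d)//; apply/ffunP => I.
  rewrite !ffunE [k *: _]mulr_sumr -big_split /=; apply: eq_bigr => L _.
  by rewrite !ffunE mulrDr; congr (_ + _); exact: mulrCA.
Qed.
HB.instance Definition _ :=
  GRing.isSubmodClosed.Build R _ smooth_section smooth_section_submod.

Record tensor := Tensor {
  tensor_comp :> chart X -> J -> 'rV[R]_(mdim X) -> R^o;
  _ : tensor_comp \in smooth_section }.
HB.instance Definition _ := [isSub for tensor_comp].
HB.instance Definition _ := [Choice of tensor by <:].
HB.instance Definition _ := [SubChoice_isSubLmodule of tensor by <:].

Definition tensor_norm (k : nat) (S : tensor) : R := Ck_norm k S.

Definition nbhd_of (T0 : tensor) (rho : R) : set tensor :=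
  [set S | tensor_norm 0 (S - T0) < rho].

End Tensors.

Section Admissible.
Variables (R : realType) (X : compact_manifold R) (p : nat).
Variable E : tensor_bundle R (mdim X).
Local Notation vec := (vec X p).
Local Notation gradient := (gradient X p).
Local Notation tensor := (tensor E).

Record remainder := Remainder {
  r1 : {linear vec -> tensor};
  r2 : {bilinear vec -> vec -> tensor};
  r3 : {bilinear gradient -> gradient -> tensor};
  r4 : {bilinear vec -> vec -> tensor}
}.

Definition bilinear_part (r : remainder) (a b : vec) : tensor :=
  r2 r a b + r3 r (grad a) (grad b) + r4 r a b.

Definition remainder_fun (r : remainder) (a : vec) : tensor :=
  r1 r a + r2 r a a + r3 r (grad a) (grad a) + r4 r a a.

Definition admissible (Ck : nat -> R) (lam ell : R) (r : remainder) : Prop :=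
  [/\ forall (a : vec) k, tensor_norm k (r1 r a) <=
        Ck k / (lam * ell) *
        \sum_(j < k.+1) vec_norm j a * lam ^+ (k - j),
      forall (a b : vec) k, tensor_norm k (r2 r a b) <=
        Ck k / (lam ^+ 2 * ell ^+ 2) *
        \sum_(j1 < k.+1) \sum_(j2 < k.+1 | (j1 + j2 <= k)%N)
          vec_norm j1 a * vec_norm j2 b * lam ^+ (k - j1 - j2),
      forall (a b : vec) k, tensor_norm k (r3 r (grad a) (grad b)) <=
        Ck k / lam ^+ 2 *
        \sum_(j1 < k.+1) \sum_(j2 < k.+1 | (j1 + j2 <= k)%N)
          grad_norm j1 (grad a) * grad_norm j2 (grad b) *
          lam ^+ (k - j1 - j2) &
      forall (a b : vec) k, tensor_norm k (r4 r a b) <=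
        Ck k / (lam ^+ 2 * ell) *
        \sum_(j1 < k.+1) \sum_(j2 < k.+1 | (j1 + j2 <= k)%N)
          vec_norm j1.+1 a * vec_norm j2 b * lam ^+ (k - j1 - j2)].

(* [b (F S) (F S) = S] on the [rho]-neighbourhood of [T0]; outside of it the
   values of [F] are irrelevant. *)
Definition inverse_near (T0 : tensor) (rho : R)
    (b : {bilinear vec -> vec -> tensor}) (F : tensor -> vec) : Prop :=
  forall S, nbhd_of T0 rho S -> b (F S) (F S) = S.

(* The recursion defining [a 1, ..., a j.+1] never leaves the
   [rho]-neighbourhood of [T0], on which the maps [F] are defined. *)
Definition recursion_defined (T0 : tensor) (rho : R) (T : tensor)
    (r : nat -> remainder) (a : nat -> vec) (j : nat) : Prop :=
  forall m, (1 <= m <= j)%N ->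
    nbhd_of T0 rho (T - remainder_fun (r m) (a m)).

Definition defect (T : tensor) (b : nat -> {bilinear vec -> vec -> tensor})
    (r : nat -> remainder) (a : nat -> vec) (j : nat) : tensor :=
  T - b j (a j) (a j) - remainder_fun (r j) (a j).

End Admissible.

(* Main.v *)
Require Import Defs.
From mathcomp Require Import all_boot all_order all_algebra.
From mathcomp Require Import all_classical all_reals all_analysis.
From mathcomp Require Import ring lra zify.

(** Write [mu = lam * ell] and [S_j = T - r^j(a^(j))], so that [S_0 = T] because
    [a^(0) = 0], and [a^(j+1) = F^(j+1)(S_j)] for every [j >= 0].

    The remainder is small.  If [|a|_0 <= A] and [|a|_k <= A lam^k / mu] for
    [k >= 1] (the predicate [controlled]), then admissibility gives
    [|r(a)|_k <= B(A) lam^k / mu] ([remainder_norm_le]): [r_1] carries the factor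
    [1 / mu], [r_2] carries [1 / mu^2], and in [r_3] and [r_4] each derivative of
    [a] costs [lam] but gains [1 / mu].  One derivative is lost, since [r_3] and
    [r_4] see [a] in [C^(k+1)].  Hence for [mu] large [S_j] stays in the
    neighbourhood on which the inverses are defined, and the bound assumed for
    [F^(j+1)] shows that [a^(j+1)] is controlled again, with a larger constant and
    one derivative fewer.  After [i] steps [k1] derivatives must remain, which
    is why [k0 = k1 + i + 1].

    The gain of a power of [mu] per step comes from the identity
    [E_(j+1) = r^j(a^(j)) - r^(j+1)(a^(j+1))], a consequence of
    [b^(j+1)(a^(j+1), a^(j+1)) = S_j].  Splitting the right-hand side into its
    linear and bilinear parts and telescoping, each piece is one of those bounded
    by [C_k lam^k / mu^(j+1)] in the inductive assumption ([remainder_diff_le]);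
    this gives (3).  The same difference, one index lower, is [S_i - S_(i-1)], and
    the estimate assumed for [F^(i+1)(S) - F^i(S')] turns it into (4).

    All of this uses that the [C^k] norms are subadditive, which rests on the
    suprema defining them being finite: the partial derivatives extend
    continuously to the images of the charts, hence are bounded on the images of
    the compact cores ([Ck_norm_has_ubound]). *)

Set Implicit Arguments.
Unset Strict Implicit.
Unset Printing Implicit Defensive.

Import Order.TTheory GRing.Theory Num.Theory.
Import numFieldNormedType.Exports.
Local Open Scope ring_scope.

(** * Finiteness and subadditivity of the C^k norms *)

Lemma ler_term_sum (R : numDomainType) (I : finType) (F : I -> R) (i : I) :
  (forall i, 0 <= F i) -> F i <= \sum_i F i.
Proof.
by move=> F0; rewrite (bigD1 i)//= lerDl; apply: sumr_ge0 => j _; exact: F0.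
Qed.

Section NormFacts.
Context {R : realType} {X : compact_manifold R}.
Local Open Scope classical_set_scope.

Section CkNorm.
Context {J : finType}.
Implicit Types f g : chart X -> J -> 'rV[R]_(mdim X) -> R^o.

Definition smooth_field f := forall c j, smooth_on (chart_img c) (f c j).

(** A partial derivative agrees in the interior of the chart image with a
    function continuous up to the boundary, and the image of the core is a compact
    subset of the chart image. *)
Lemma partials_bounded f c j s : smooth_field f ->
  exists2 M, 0 <= M & forall x, (phi c @` chart_core c) x -> (chart_img c)° x ->
    `|partials s (f c j) x| <= M.
Proof.
move=> fs; have [_ /(_ s)[g gc fg]] := fs c j.
have KD : phi c @` chart_core c `<=` chart_img c.
  by apply: image_subset; exact: chart_core_sub.
have Kc : compact (phi c @` chart_core c).
  apply: continuous_compact; last exact: chart_core_compact.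
  apply: (continuous_subspaceW (@chart_core_sub _ _ c)).
  exact: phi_continuous.
have gKc : compact (g @` (phi c @` chart_core c)).
  by apply: continuous_compact => //; exact: continuous_subspaceW KD gc.
have [M [_ gM]] := compact_bounded gKc.
exists `|M + 1| => [//|x Kx Dx]; rewrite fg//; apply: gM; last by exists x.
by apply: lt_le_trans (ler_norm _); rewrite ltrDl.
Qed.

(** There are finitely many charts, components and multi-indices of length at
    most [k], so the sum of the individual bounds is a bound for all. *)
Lemma Ck_norm_has_ubound f k : smooth_field f ->
  has_ubound [set y | exists c j s x,
    [/\ (size s <= k)%N, (phi c @` chart_core c) x, (chart_img c)° x &
        y = `|partials s (f c j) x|]].
Proof.
move=> fs.
pose P (u : chart X * J * seq 'I_(mdim X)) M := 0 <= M /\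
  forall x, (phi u.1.1 @` chart_core u.1.1) x -> (chart_img u.1.1)° x ->
  `|partials u.2 (f u.1.1 u.1.2) x| <= M.
have /choice[M MP] : forall u, exists M, P u M.
  by move=> [[c j] s]; have [M M0 fM] := partials_bounded c j s fs; exists M.
have M0 u : 0 <= M u by case: (MP u).
exists (\sum_c \sum_j \sum_(m < k.+1) \sum_(t : m.-tuple 'I_(mdim X))
  M (c, j, tval t)) => y [c [j [s [x [sk Kx Dx ->]]]]].
apply: le_trans ((MP (c, j, s)).2 x Kx Dx) _.
pose m : 'I_k.+1 := Ordinal (n := k.+1) (m := size s) sk.
apply: le_trans (@ler_term_sum R _ _ c _) => [|c'].
  apply: le_trans (@ler_term_sum R _ _ j _) => [|j'].
    apply: le_trans (@ler_term_sum R _ _ m _) => [|m'].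
      exact: (@ler_term_sum R _ (fun t : m.-tuple _ => M (c, j, tval t))
        (in_tuple s)).
    by rewrite sumr_ge0.
  by rewrite sumr_ge0// => m' _; rewrite sumr_ge0.
rewrite sumr_ge0// => j' _; rewrite sumr_ge0// => m' _.
by rewrite sumr_ge0.
Qed.

Lemma partials_le_Ck_norm f k c j s x : smooth_field f -> (size s <= k)%N ->
  (phi c @` chart_core c) x -> (chart_img c)° x ->
  `|partials s (f c j) x| <= Ck_norm k f.
Proof.
move=> fs sk Kx Dx; apply: ub_le_sup; first exact: Ck_norm_has_ubound.
by exists c, j, s, x.
Qed.

(** The bound [B] must be nonnegative because the supremum is 0 when no point
    qualifies, for instance when the chart images have empty interior. *)
Lemma Ck_norm_le f k B : 0 <= B ->
  (forall c j s x, (size s <= k)%N -> (phi c @` chart_core c) x ->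
    (chart_img c)° x -> `|partials s (f c j) x| <= B) ->
  Ck_norm k f <= B.
Proof.
move=> B0 fB; rewrite /Ck_norm.
set A := [set y | _]; have [->|A0] := eqVneq A set0; first by rewrite sup0.
apply: ge_sup; first exact/set0P.
by move=> y [c [j [s [x [sk Kx Dx ->]]]]]; exact: fB.
Qed.

Lemma Ck_norm_ge0 f k : 0 <= Ck_norm k f.
Proof.
rewrite /Ck_norm; set A := [set y | _].
have [Asup|/sup_out->//] := pselect (has_sup A).
have [[y Ay] Aub] := Asup; apply: (@le_trans _ _ y); last exact: ub_le_sup.
by case: Ay => c [j [s [x [_ _ _ ->]]]].
Qed.

Lemma Ck_norm_lin (e : R) f g k : smooth_field f -> smooth_field g ->
  Ck_norm k (e *: f + g) <= `|e| * Ck_norm k f + Ck_norm k g.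
Proof.
move=> fs gs; apply: Ck_norm_le => [|c j s x sk Kx Dx].
  by rewrite addr_ge0 ?mulr_ge0 ?Ck_norm_ge0.
rewrite [X in `|X|](partials_lin e (fs c j) (gs c j) s Dx).
rewrite (le_trans (ler_normD _ _))// normrM lerD ?ler_wpM2l//.
- exact: partials_le_Ck_norm.
- exact: partials_le_Ck_norm.
Qed.

End CkNorm.

Lemma smooth_vcomp p (a : vec X p) : smooth_field (vcomp a).
Proof. by move=> c j; have /asboolP[_] := valP a; exact. Qed.

Lemma partials_patch n (D : set 'rV[R]_n) (f : 'rV[R]_n -> R^o) s x :
  D° x -> partials s (f \_ D°) x = partials s f x.
Proof.
elim: s x => [|i s IHs] x Dx /=; first by rewrite patchT// inE.
apply: near_eq_derive; near=> y; apply: IHs.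
by near: y; exact: open_nbhs_nbhs (conj (@open_interior _ D) Dx).
Unshelve. all: by end_near. Qed.

Lemma vec_norm_ge0 p k (a : vec X p) : 0 <= vec_norm k a.
Proof. exact: Ck_norm_ge0. Qed.

Lemma grad_norm_ge0 p k (g : gradient X p) : 0 <= grad_norm k g.
Proof. exact: Ck_norm_ge0. Qed.

(** The components of the gradient are cut off to 0 outside the open interior of
    the chart image, which leaves their derivatives in the interior unchanged. *)
Lemma grad_norm_le p k (a : vec X p) : grad_norm k (grad a) <= vec_norm k.+1 a.
Proof.
apply: Ck_norm_le => [|c [j i] s x sk Kx Dx]; first exact: vec_norm_ge0.
rewrite /= /grad_comp /= partials_patch//.
have -> : partials s (partial i (vcomp a c j)) =
    partials (s ++ [:: i]) (vcomp a c j).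
  by rewrite /partials foldr_cat.
by apply: partials_le_Ck_norm => //; [exact: smooth_vcomp|rewrite size_cat addn1].
Qed.

Lemma grad_lin p (e : R) (a b : vec X p) :
  grad (e *: a + b) = e *: grad a + grad b.
Proof. by apply: val_inj; exact: grad_comp_lin. Qed.

Lemma gradB p (a b : vec X p) : grad (a - b) = grad a - grad b.
Proof. by rewrite addrC -scaleN1r grad_lin scaleN1r addrC. Qed.

Section TensorNorm.
Context {E : tensor_bundle R (mdim X)}.
Implicit Types S : tensor E.

Lemma smooth_tensor S : smooth_field S.
Proof. by move=> c j; have /asboolP[Ssm _ _ _] := valP S; exact: Ssm. Qed.

Lemma tensor_norm_ge0 k S : 0 <= tensor_norm k S.
Proof. exact: Ck_norm_ge0. Qed.

Lemma tensor_norm_lin k (e : R) (S S' : tensor E) :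
  tensor_norm k (e *: S + S') <= `|e| * tensor_norm k S + tensor_norm k S'.
Proof.
have valE : tensor_comp (e *: S + S') = e *: tensor_comp S + tensor_comp S'.
  exact: erefl.
rewrite /tensor_norm valE.
apply: (@Ck_norm_lin _ e (tensor_comp S) (tensor_comp S') k).
  exact: smooth_tensor.
exact: smooth_tensor.
Qed.

Lemma tensor_normD k (S S' : tensor E) :
  tensor_norm k (S + S') <= tensor_norm k S + tensor_norm k S'.
Proof. by have := tensor_norm_lin k 1 S S'; rewrite scale1r normr1 mul1r. Qed.

Lemma tensor_normB k (S S' : tensor E) :
  tensor_norm k (S - S') <= tensor_norm k S + tensor_norm k S'.
Proof.
rewrite addrC -scaleN1r (le_trans (tensor_norm_lin _ _ _ _))//.
by rewrite normrN1 mul1r addrC.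
Qed.

Lemma tensor_norm0 k : tensor_norm k (0 : tensor E) = 0.
Proof.
apply/le_anti; rewrite tensor_norm_ge0 andbT.
have valE : tensor_comp 0 = -1 *: tensor_comp (0 : tensor E) + tensor_comp 0.
  by rewrite scaleN1r addNr.
apply: Ck_norm_le => // c j s x _ _ Dx.
rewrite valE [X in `|X|](partials_lin (-1) (smooth_tensor 0 c j)
  (smooth_tensor 0 c j) s Dx).
by rewrite scaleN1r addNr normr0.
Qed.

End TensorNorm.
End NormFacts.

(** * The sums in the admissibility estimates *)

Section ProductSums.
Context {R : numFieldType}.
Implicit Types (lam U V : R) (u v : nat -> R).

Lemma sum_shift_le k lam U u : 0 <= lam ->
  (forall j, (j <= k)%N -> u j <= U * lam ^+ j) ->
  \sum_(j < k.+1) u j * lam ^+ (k - j) <= k.+1%:R * (U * lam ^+ k).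
Proof.
move=> lam0 uU.
have -> : k.+1%:R * (U * lam ^+ k) = \sum_(j < k.+1) U * lam ^+ k.
  by rewrite sumr_const card_ord mulr_natl.
apply: ler_sum => -[j /= jk] _.
rewrite -[in leRHS](subnKC (jk : (j <= k)%N)) exprD mulrA.
by rewrite ler_wpM2r ?exprn_ge0// uU.
Qed.

(** If [u] and [v] grow like [lam ^+ j], every term of the sum scales like
    [lam ^+ k], and there are at most [k.+1 ^ 2] terms. *)
Lemma product_sum_le k lam U V u v : 0 <= lam -> 0 <= U -> 0 <= V ->
  (forall j, (j <= k)%N -> 0 <= u j <= U * lam ^+ j) ->
  (forall j, (j <= k)%N -> 0 <= v j <= V * lam ^+ j) ->
  \sum_(j1 < k.+1) \sum_(j2 < k.+1 | (j1 + j2 <= k)%N)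
    u j1 * v j2 * lam ^+ (k - j1 - j2) <=
  k.+1%:R ^+ 2 * (U * V * lam ^+ k).
Proof.
move=> lam0 U0 V0 uU vV; set B := U * V * lam ^+ k.
have B0 : 0 <= B by rewrite !mulr_ge0 ?exprn_ge0.
have -> : k.+1%:R ^+ 2 * B = \sum_(j1 < k.+1) \sum_(j2 < k.+1) B.
  by rewrite !sumr_const !card_ord -mulrnA -[RHS]mulr_natl natrM.
apply: ler_sum => -[j1 /= j1k] _; rewrite big_mkcond.
apply: ler_sum => -[j2 /= j2k] _; case: ifPn => // j12.
have -> : B = (U * lam ^+ j1) * (V * lam ^+ j2) * lam ^+ (k - j1 - j2).
  rewrite /B -subnDA -[in LHS](subnKC j12) !exprD; ring.
have /andP[u0 u1] := uU j1 j1k; have /andP[v0 v1] := vV j2 j2k.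
by rewrite ler_wpM2r ?exprn_ge0// ler_pM.
Qed.

End ProductSums.

(** * Estimates for remainders *)

Section ZmoduleIdentities.
Context {V : zmodType}.

Lemma sub_sum3 (x y z x' y' z' : V) :
  (x - x') + (y - y') + (z - z') = (x + y + z) - (x' + y' + z').
Proof. by rewrite [X in X + _ = _]addrACA -opprD addrACA -opprD. Qed.

(** Here [l], [l'], [l''] play the linear parts, [q], [q'], [q''] the quadratic
    ones, and [q0] the mixed value of the bilinear part. *)
Lemma telescope_sub (l l' l'' q q' q'' q0 : V) :
  ((l - l') + (l' - l'') + ((q - q0) - (q' - q0))) - (q'' - q') =
  (l + q) - (l'' + q'').
Proof. by rewrite !opprB subrKA subrKA -[LHS]addrA subrKA opprD addrACA. Qed.

End ZmoduleIdentities.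

Section Remainder.
Context {R : realType} {X : compact_manifold R} {p : nat}.
Context {E : tensor_bundle R (mdim X)}.
Implicit Types (r : remainder p E) (a : vec X p).

Lemma remainder_funE r a : remainder_fun r a = r1 r a + bilinear_part r a a.
Proof. by rewrite /remainder_fun /bilinear_part !addrA. Qed.

Lemma bilinear_partBl r a b c :
  bilinear_part r (a - b) c = bilinear_part r a c - bilinear_part r b c.
Proof.
rewrite /bilinear_part gradB.
have -> := linearBl (r2 r) c a b.
have -> := linearBl (r3 r) (grad c) (grad a) (grad b).
have -> := linearBl (r4 r) c a b.
exact: sub_sum3.
Qed.

Lemma bilinear_partBr r a b c :
  bilinear_part r c (a - b) = bilinear_part r c a - bilinear_part r c b.
Proof.
rewrite /bilinear_part gradB.
have -> := linearB (r2 r c) a b.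
have -> := linearB (r3 r (grad c)) (grad a) (grad b).
have -> := linearB (r4 r c) a b.
exact: sub_sum3.
Qed.

Lemma remainder_fun0 r : remainder_fun r 0 = 0.
Proof.
have g0 : grad (0 : vec X p) = 0 by rewrite -[0 in LHS](subrr 0) gradB subrr.
by rewrite /remainder_fun g0 linear0 !linear0l !addr0.
Qed.

(** Passing from [(r, a)] to [(r', b)] changes the argument first and the map
    second; the quadratic part changes one slot at a time. *)
Lemma remainder_diff_le r r' a b k e :
  tensor_norm k (r1 r a - r1 r b) + tensor_norm k (r1 r b - r1 r' b) <= e ->
  tensor_norm k (bilinear_part r' b b - bilinear_part r b b) <= e ->
  tensor_norm k (bilinear_part r b (b - a)) +
    tensor_norm k (bilinear_part r (a - b) a) <= e ->
  tensor_norm k (remainder_fun r a - remainder_fun r' b) <= 3 * e.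
Proof.
move=> e1 e2 e3.
have -> : remainder_fun r a - remainder_fun r' b =
    (r1 r a - r1 r b) + (r1 r b - r1 r' b) +
    (bilinear_part r (a - b) a - bilinear_part r b (b - a)) -
    (bilinear_part r' b b - bilinear_part r b b).
  rewrite !remainder_funE bilinear_partBl bilinear_partBr.
  exact/esym/telescope_sub.
have := tensor_normB k ((r1 r a - r1 r b) + (r1 r b - r1 r' b) +
    (bilinear_part r (a - b) a - bilinear_part r b (b - a)))
    (bilinear_part r' b b - bilinear_part r b b).
have := tensor_normD k ((r1 r a - r1 r b) + (r1 r b - r1 r' b))
    (bilinear_part r (a - b) a - bilinear_part r b (b - a)).
have := tensor_normD k (r1 r a - r1 r b) (r1 r b - r1 r' b).
have := tensor_normB k (bilinear_part r (a - b) a) (bilinear_part r b (b - a)).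
lra.
Qed.

(** The profile shared by all iterates: of size one, with derivatives of size
    [lam ^+ k] that are smaller by a factor [mu^-1]. *)
Definition controlled (lam mu A : R) (n : nat) a :=
  vec_norm 0 a <= A /\
  forall k, (1 <= k <= n)%N -> vec_norm k a <= A * (lam ^+ k / mu).

(** The strict inequality [k < n] is the loss of one derivative in [r3] and [r4].
    The quadratic terms even carry [mu ^- 2], of which one factor is dropped. *)
Lemma remainder_norm_le (Ck : nat -> R) (lam ell M A : R) (n k : nat) r a :
  0 < lam -> 0 < ell -> 1 <= lam * ell -> 0 <= A -> 0 <= Ck k <= M ->
  (k < n)%N -> admissible Ck lam ell r -> controlled lam (lam * ell) A n a ->
  tensor_norm k (remainder_fun r a) <=
    M * k.+1%:R ^+ 2 * (A + 3 * A ^+ 2) * (lam ^+ k / (lam * ell)).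
Proof.
move=> lam0 ell0 mu1 A0 /andP[Ck0 CkM] kn [r1E r2E r3E r4E] [aA aAk].
set mu := lam * ell in mu1 r1E aA aAk *.
have mu0 : 0 < mu by rewrite (lt_le_trans ltr01).
have lamX j : 0 <= lam ^+ j by rewrite exprn_ge0// ltW.
have imu1 : mu^-1 <= 1 by rewrite invf_le1.
have a0 j : (j <= k)%N -> 0 <= vec_norm j a <= A * lam ^+ j.
  move=> jk; rewrite vec_norm_ge0 /=; case: j jk => [|j] jk.
    by rewrite expr0 mulr1.
  apply: le_trans (aAk j.+1 (ltn_trans jk kn)) _.
  by rewrite ler_wpM2l// ler_piMr.
have a1 j : (j <= k)%N -> 0 <= vec_norm j.+1 a <= A * (lam / mu) * lam ^+ j.
  move=> jk; rewrite vec_norm_ge0 /=.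
  have -> : A * (lam / mu) * lam ^+ j = A * (lam ^+ j.+1 / mu).
    by rewrite exprS; ring.
  by apply: aAk; exact: leq_ltn_trans jk kn.
have g1 j : (j <= k)%N ->
    0 <= grad_norm j (grad a) <= A * (lam / mu) * lam ^+ j.
  move=> jk; rewrite grad_norm_ge0 /= (le_trans (grad_norm_le _ _))//.
  by case/andP: (a1 j jk).
have W0 : 0 <= A * (lam / mu) by rewrite mulr_ge0// divr_ge0// ltW.
have N1 : 1 <= k.+1%:R :> R by rewrite ler1n.
set N := k.+1%:R in N1 *.
set L := lam ^+ k.
have L0 : 0 <= L := lamX k.
have {}r1E : tensor_norm k (r1 r a) <= M * N ^+ 2 * A * (L / mu).
  apply: le_trans (r1E a k) _.
  have -> : M * N ^+ 2 * A * (L / mu) = M / mu * (N ^+ 2 * (A * L)).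
    by ring.
  apply: ler_pM => //.
  - by rewrite divr_ge0// ltW.
  - apply: sumr_ge0 => j _; rewrite mulr_ge0 ?vec_norm_ge0//.
  - by rewrite ler_wpM2r// invr_ge0 ltW.
  - apply: le_trans (sum_shift_le (ltW lam0)
      (fun j jk => proj2 (andP (a0 j jk)))) _.
    by rewrite ler_wpM2r ?mulr_ge0// ler_eXnr.
(* The three quadratic terms differ only in their prefactor [e] and in the
   growth constants [U] and [V] of the two slots. *)
have quad (e P U V : R) t : 0 <= e -> e * (U * V) <= A ^+ 2 / mu ->
    t <= Ck k * e * P -> P <= N ^+ 2 * (U * V * L) ->
    t <= M * N ^+ 2 * A ^+ 2 * (L / mu).
  move=> e0 eUV tP PUV; apply: le_trans tP _.
  apply: le_trans (ler_wpM2l _ PUV) _; first by rewrite mulr_ge0.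
  have -> : Ck k * e * (N ^+ 2 * (U * V * L)) =
    Ck k * (e * (U * V)) * (N ^+ 2 * L) by ring.
  have -> : M * N ^+ 2 * A ^+ 2 * (L / mu) =
    M * (A ^+ 2 / mu) * (N ^+ 2 * L) by ring.
  apply: ler_wpM2r; first by rewrite mulr_ge0// exprn_ge0// (le_trans _ N1).
  apply: le_trans (ler_wpM2l Ck0 eUV) _.
  by rewrite ler_wpM2r// divr_ge0 ?exprn_ge0// ltW.
have mu_sq c : 0 <= c -> c / mu ^+ 2 <= c / mu.
  move=> c0; rewrite ler_wpM2l// lef_pV2 ?posrE ?exprn_gt0//.
  by rewrite expr2 ler_peMl// ltW.
have lamN0 : lam != 0 by rewrite gt_eqF.
have ellN0 : ell != 0 by rewrite gt_eqF.
have A20 : 0 <= A ^+ 2 by rewrite exprn_ge0.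
have {}r2E := quad _ _ _ _ _ _ _ (r2E a a k)
  (product_sum_le (ltW lam0) A0 A0 a0 a0).
have {}r3E := quad _ _ _ _ _ _ _ (r3E a a k)
  (product_sum_le (ltW lam0) W0 W0 g1 g1).
have {}r4E := quad _ _ _ _ _ _ _ (r4E a a k)
  (product_sum_le (ltW lam0) W0 A0 a1 a0).
have {}r2E : tensor_norm k (r2 r a a) <= M * N ^+ 2 * A ^+ 2 * (L / mu).
  apply: r2E; first by rewrite invr_ge0 mulr_ge0 ?exprn_ge0// ltW.
  apply: le_trans (mu_sq _ A20).
  by rewrite /mu le_eqVlt; apply/orP; left; apply/eqP; field; rewrite ?lamN0 ?ellN0.
have {}r3E : tensor_norm k (r3 r (grad a) (grad a)) <=
    M * N ^+ 2 * A ^+ 2 * (L / mu).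
  apply: r3E; first by rewrite invr_ge0 ?exprn_ge0// ltW.
  apply: le_trans (mu_sq _ A20).
  by rewrite /mu le_eqVlt; apply/orP; left; apply/eqP; field; rewrite ?lamN0 ?ellN0.
have {}r4E : tensor_norm k (r4 r a a) <= M * N ^+ 2 * A ^+ 2 * (L / mu).
  apply: r4E; first by rewrite invr_ge0 mulr_ge0 ?exprn_ge0// ltW.
  apply: le_trans (mu_sq _ A20).
  by rewrite /mu le_eqVlt; apply/orP; left; apply/eqP; field; rewrite ?lamN0 ?ellN0.
rewrite /remainder_fun.
have := tensor_normD k (r1 r a + r2 r a a + r3 r (grad a) (grad a)) (r4 r a a).
have := tensor_normD k (r1 r a + r2 r a a) (r3 r (grad a) (grad a)).
have := tensor_normD k (r1 r a) (r2 r a a).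
lra.
Qed.


End Remainder.

(** * The iteration *)

Theorem proposition4p1 (R : realType) (k1 i : nat) (i_ge1 : (1 <= i)%N) :
  exists k0 : nat,
  forall (X : compact_manifold R) (p : nat) (E : tensor_bundle R (mdim X))
    (T0 : tensor E) (Cs C : R) (Ck : nat -> R),
  0 < Cs -> 0 < C -> (forall k, 0 < Ck k) ->
  exists (Lam C' : R) (Cks : nat -> R),
  forall lam ell : R, 0 < lam -> 0 < ell -> Lam <= lam * ell ->
  forall (b : nat -> {bilinear vec X p -> vec X p -> tensor E})
    (F : nat -> tensor E -> vec X p),
  (forall j, (1 <= j <= i.+1)%N -> inverse_near T0 (3 / Cs) (b j) (F j)) ->
  (forall j S k, (1 <= j <= i.+1)%N -> nbhd_of T0 (3 / Cs) S ->
    (k <= k0.+1)%N ->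
    vec_norm k (F j S) <=
      Cs * (tensor_norm k S + lam ^+ k / (lam * ell))) ->
  (forall j S S' k, (1 <= j <= i)%N ->
    nbhd_of T0 (3 / Cs) S -> nbhd_of T0 (3 / Cs) S' -> (k <= k0.+1)%N ->
    vec_norm k (F j.+1 S - F j S') <=
      Cs * (tensor_norm k (S - S') + lam ^+ k / (lam * ell) ^+ j +
            (tensor_norm k S' + lam ^+ k) *
            (tensor_norm 0 (S - S') + 1 / (lam * ell) ^+ j))) ->
  forall T : tensor E,
  nbhd_of T0 (1 / (3 * Cs)) T ->
  (forall k, (1 <= k)%N -> tensor_norm k T <= C * (lam ^+ k / (lam * ell))) ->
  forall (r : nat -> remainder p E) (a : nat -> vec X p),
  (forall j, (1 <= j <= i.+1)%N -> admissible Ck lam ell (r j)) ->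
  a 0%N = 0 ->
  a 1%N = F 1%N T ->
  (forall j, (1 <= j <= i)%N -> recursion_defined T0 (3 / Cs) T r a j ->
    a j.+1 = F j.+1 (T - remainder_fun (r j) (a j))) ->
  vec_norm 0 (a 1%N) <= C ->
  (forall k, (1 <= k)%N -> (k + 1 <= k0)%N ->
    vec_norm k (a 1%N) <= C * (lam ^+ k / (lam * ell))) ->
  (forall k, (k + 1 <= k0)%N ->
    tensor_norm k (defect T b r a 1) <= C * (lam ^+ k / (lam * ell))) ->
  (forall j, (1 <= j <= i)%N -> recursion_defined T0 (3 / Cs) T r a j ->
    forall k, (k + j + 1 <= k0)%N ->
    [/\ tensor_norm k (r1 (r j) (a j) - r1 (r j) (a j.+1)) +
        tensor_norm k (r1 (r j) (a j.+1) - r1 (r j.+1) (a j.+1))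
          <= Ck k * lam ^+ k / (lam * ell) ^+ j.+1,
        tensor_norm k (bilinear_part (r j.+1) (a j.+1) (a j.+1) -
                       bilinear_part (r j) (a j.+1) (a j.+1))
          <= Ck k * lam ^+ k / (lam * ell) ^+ j.+1 &
        tensor_norm k (bilinear_part (r j) (a j.+1) (a j.+1 - a j)) +
        tensor_norm k (bilinear_part (r j) (a j - a j.+1) (a j))
          <= Ck k * lam ^+ k / (lam * ell) ^+ j.+1]) ->
  recursion_defined T0 (3 / Cs) T r a i /\
  [/\ vec_norm 0 (a i.+1) <= C',
      forall k, (1 <= k <= k1)%N ->
        vec_norm k (a i.+1) <= C' * (lam ^+ k / (lam * ell)),
      forall k, (k <= k1)%N ->
        tensor_norm k (defect T b r a i.+1) <=
          C' * (lam ^+ k / (lam * ell) ^+ i) &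
      forall k, (k <= k1)%N ->
        vec_norm k (a i.+1 - a i) <= Cks k * (lam ^+ k / (lam * ell) ^+ i)].
Proof.
exists (k1 + i).+1 => X p E T0 Cs C Ck Cs0 C0 Ck0; set k0 := (k1 + i).+1.
pose M := \sum_(k < k0.+1) Ck k.
pose D := tensor_norm 0 T0 + 1 / (3 * Cs) + C + 1.
pose B A := M * k0.+1%:R ^+ 2 * (A + 3 * A ^+ 2).
(* [A_ j] controls [a j]: adding the previous value makes the sequence
   nondecreasing, so that its last value [G] controls all iterates. *)
pose A_ j := iter j (fun x => x + Cs * (D + B x)) C.
pose G := A_ i.+1.
(* [V] bounds [S i - S i.-1] in units of [lam ^+ k / mu ^+ i]: the first summand
   serves for [i = 1], the second for [i > 1]. *)
pose V := B G + 3 * M.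
exists (1 + Cs * B G), (G + 3 * M),
  (fun=> Cs * (V + 1 + (D + B G) * (V + 1))).
have CkM k : (k <= k0)%N -> 0 <= Ck k <= M.
  move=> kk0; rewrite ltW//=.
  apply: (@ler_term_sum _ _ (fun k : 'I_k0.+1 => Ck k)
    (Ordinal (kk0 : (k < k0.+1)%N))).
  by move=> ?; exact: ltW.
have M0 : 0 <= M by have /andP[/le_trans] := CkM 0%N isT; apply.
have t0 : 0 <= tensor_norm 0 T0 by exact: tensor_norm_ge0.
have c0 : 0 < 1 / (3 * Cs) by rewrite divr_gt0// mulr_gt0.
have D0 : 0 <= D by rewrite /D; lra.
have B0 A : 0 <= A -> 0 <= B A.
  by move=> A0; rewrite /B !mulr_ge0 ?exprn_ge0// addr_ge0// mulr_ge0 ?exprn_ge0.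
have BW A A' : 0 <= A -> A <= A' -> B A <= B A'.
  move=> A0 AA'; rewrite /B ler_wpM2l ?mulr_ge0 ?exprn_ge0// lerD// ler_wpM2l//.
  by rewrite lerXn2r// nnegrE// (le_trans A0).
have A0 j : 0 <= A_ j.
  elim: j => [|j IHj]; first exact: ltW.
  by rewrite /= addr_ge0// mulr_ge0 ?(ltW Cs0)// addr_ge0// B0.
have AS j : A_ j.+1 = A_ j + Cs * (D + B (A_ j)) by [].
have AW : {homo A_ : m n / (m <= n)%N >-> m <= n}.
  apply: homo_leq => [x//|y x z /le_trans|j]; first exact.
  by rewrite AS lerDl mulr_ge0 ?(ltW Cs0)// addr_ge0// B0.
have G0 : 0 <= G := A0 _.
have BG0 := B0 _ G0.
have V0 : 0 <= V by rewrite addr_ge0// mulr_ge0.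
move=> lam ell lam0 ell0.
set mu := lam * ell => muL b F bF FB FD T Tnear TB r a radm a0 a1 aS a10 a1B E1 hyp.
have mu1 : 1 <= mu by apply: le_trans muL; rewrite lerDl mulr_ge0// ltW.
have mu0 : 0 < mu by exact: lt_le_trans mu1.
(* The choice of the threshold for [mu]: the remainders are smaller than [1 / Cs]
   in [C^0], and [1 / (3 * Cs) + 1 / Cs < 3 / Cs]. *)
have BGmu : B G / mu < 1 / Cs.
  by rewrite ltr_pdivrMr// mulrAC ltr_pdivlMr// mul1r mulrC; move: muL; lra.
have L0 k : 0 <= lam ^+ k by rewrite exprn_ge0// ltW.
have Lmu k : lam ^+ k / mu <= lam ^+ k by rewrite ler_piMr// invf_le1.
have Lmu0 k : 0 <= lam ^+ k / mu by rewrite divr_ge0// ltW.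
pose S j := T - remainder_fun (r j) (a j).
have S0E : S 0%N = T by rewrite /S a0 remainder_fun0 subr0.
have aE j : (j <= i)%N -> recursion_defined T0 (3 / Cs) T r a j ->
    a j.+1 = F j.+1 (S j).
  by case: j => [_ _|j ji]; [rewrite S0E|exact: aS].
have T00 : tensor_norm 0 T <= tensor_norm 0 T0 + 1 / (3 * Cs).
  have := tensor_normD 0 (T - T0) T0; rewrite subrK => /le_trans; apply.
  by rewrite addrC lerD2l ltW.
have remB A j k : 0 <= A -> (1 <= j <= i.+1)%N -> (k < k0 - j)%N ->
    controlled lam mu A (k0 - j) (a j) ->
    tensor_norm k (remainder_fun (r j) (a j)) <= B A * (lam ^+ k / mu).
  move=> Age0 ji kj aj.
  have kk0 : (k <= k0)%N by rewrite (leq_trans (ltnW kj))// leq_subr.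
  apply: le_trans (remainder_norm_le lam0 ell0 mu1 Age0 (CkM _ kk0) kj
    (radm _ ji) aj) _.
  rewrite ler_wpM2r// ler_wpM2r ?addr_ge0 ?mulr_ge0 ?exprn_ge0// ler_wpM2l//.
  by rewrite lerXn2r ?nnegrE// ler_nat.
have near_S j :
    tensor_norm 0 (remainder_fun (r j) (a j)) <= B G * (lam ^+ 0 / mu) ->
    nbhd_of T0 (3 / Cs) (S j).
  move=> rj; rewrite /nbhd_of /= /S addrAC.
  apply: le_lt_trans (tensor_normB _ _ _) _.
  move: rj Tnear; rewrite expr0 /nbhd_of /= => rj Tnear.
  have -> : 3 / Cs = 9 * (1 / (3 * Cs)) by field; rewrite gt_eqF.
  have : 1 / Cs = 3 * (1 / (3 * Cs)) by field; rewrite gt_eqF.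
  move: BGmu rj Tnear; rewrite mul1r; lra.
(* Each step consumes one derivative, hence the order [k0 - j.+1]. *)
have main j : (j <= i)%N -> recursion_defined T0 (3 / Cs) T r a j /\
    controlled lam mu (A_ j.+1) (k0 - j.+1) (a j.+1).
  elim: j => [_|j IHj ji].
    split; first by move=> [|[]].
    have CA : C <= A_ 1%N by exact: (AW 0%N).
    split=> [|k k1k]; first exact: le_trans a10 CA.
    apply: le_trans (ler_wpM2r (Lmu0 k) CA).
    by apply: a1B; move: k1k; rewrite /k0; clear; lia.
  have [rj aj] := IHj (ltnW ji).
  have j1i : (1 <= j.+1 <= i.+1)%N by move: ji; clear; lia.
  have rB k kj := remB _ j.+1 k (A0 _) j1i kj aj.
  have rj1 : recursion_defined T0 (3 / Cs) T r a j.+1.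
    move=> m /andP[m1]; rewrite leq_eqVlt => /predU1P[->|mj]; last first.
      by apply: rj; rewrite m1.
    apply: near_S; apply: le_trans (rB 0%N _) _.
      by move: ji; rewrite /k0; clear; lia.
    by rewrite ler_wpM2r// BW// AW// ltnW.
  split=> //.
  have Snear : nbhd_of T0 (3 / Cs) (S j.+1) by apply: rj1; rewrite ltnS leqnn.
  have FS k : (k <= k0 - j.+2)%N -> vec_norm k (a j.+2) <=
      Cs * (tensor_norm k T + B (A_ j.+1) * (lam ^+ k / mu) + lam ^+ k / mu).
    move=> kj; rewrite aE//; apply: le_trans (FB _ _ _ _ Snear _) _.
    - by move: ji; clear; lia.
    - by move: kj; clear; lia.
    rewrite ler_wpM2l ?(ltW Cs0)// lerD2r.
    apply: le_trans (tensor_normB _ _ _) _; rewrite lerD2l; apply: rB.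
    by move: kj ji; rewrite /k0; clear; lia.
  have Aj0 := A0 j.+1.
  split=> [|k /andP[k1' kj]]; rewrite AS.
    apply: le_trans (FS 0%N _) _; first by [].
    have x1 := Lmu 0%N; rewrite expr0 in x1 *.
    have Bx := ler_wpM2l (B0 _ Aj0) x1.
    have : tensor_norm 0 T + B (A_ j.+1) * (1 / mu) + 1 / mu <= D + B (A_ j.+1).
      by move: C0 T00 Bx x1; rewrite mulr1 /D; lra.
    by move=> /(ler_wpM2l (ltW Cs0))/le_trans; apply; rewrite lerDr.
  apply: le_trans (FS k kj) _.
  rewrite mulrDl -mulrA; apply: ler_wpDl; first by rewrite mulr_ge0.
  rewrite ler_wpM2l ?(ltW Cs0)// mulrDl.
  have Dx : (C + 1) * (lam ^+ k / mu) <= D * (lam ^+ k / mu).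
    by apply: ler_wpM2r => //; move: t0 c0; rewrite /D; lra.
  by move: (TB k k1') Dx; lra.
have [reci ai] := main i (leqnn i).
have recj j : (j <= i)%N -> recursion_defined T0 (3 / Cs) T r a j.
  by move=> ji m /andP[m1 mj]; apply: reci; rewrite m1 (leq_trans mj).
have rdiff j k : (1 <= j <= i)%N -> (k + j + 1 <= k0)%N ->
    tensor_norm k (remainder_fun (r j) (a j) -
                   remainder_fun (r j.+1) (a j.+1)) <=
    3 * M * (lam ^+ k / mu ^+ j.+1).
  move=> ji kj; have [|e1 e2 e3] := hyp j ji _ k kj.
    by apply: recj; case/andP: ji.
  apply: le_trans (remainder_diff_le e1 e2 e3) _.
  rewrite -!mulrA ler_wpM2l//.
  rewrite ler_wpM2r ?divr_ge0 ?exprn_ge0 ?(ltW mu0) ?(ltW lam0)//.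
  by have /andP[] := CkM k (leq_trans (leq_trans (leq_addr _ _) (leq_addr _ _)) kj).
(* The index [j = 0] is included, where the remainder vanishes. *)
have remG j k : (j <= i)%N -> (k < k0 - j)%N ->
    tensor_norm k (remainder_fun (r j) (a j)) <= B G * (lam ^+ k / mu).
  case: j => [_ _|j ji kj].
    by rewrite a0 remainder_fun0 tensor_norm0 mulr_ge0.
  have [_ aj] := main j (ltnW ji).
  apply: le_trans (remB _ _ _ (A0 _) _ kj aj) _; first by move: ji; clear; lia.
  by rewrite ler_wpM2r// BW// AW// ltnW.
have Snear j : (j <= i)%N -> nbhd_of T0 (3 / Cs) (S j).
  case: j => [_|j ji]; last by apply: reci; rewrite ji.
  rewrite S0E /nbhd_of /=; move: Tnear; rewrite /nbhd_of /=.
  have -> : 3 / Cs = 9 * (1 / (3 * Cs)) by field; rewrite gt_eqF.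
  by move: c0; lra.
have ck0 : (k0 - i.+1 = k1)%N by rewrite /k0; clear; lia.
split=> //; split.
- by case: ai => /le_trans + _; apply; rewrite lerDl mulr_ge0.
- move=> k k1k; case: ai => _ /(_ k); rewrite ck0 => /(_ k1k)/le_trans; apply.
  by rewrite ler_wpM2r// lerDl mulr_ge0.
- move=> k kk1.
  have bS : b i.+1 (a i.+1) (a i.+1) = S i.
    by rewrite aE//; apply: bF (Snear _ (leqnn i)); rewrite ltnS leqnn.
  (* The defect is the change of the remainder in the last step. *)
  have -> : defect T b r a i.+1 =
      remainder_fun (r i) (a i) - remainder_fun (r i.+1) (a i.+1).
    by rewrite /defect bS /S subKr.
  have /le_trans : tensor_norm k (remainder_fun (r i) (a i) -
      remainder_fun (r i.+1) (a i.+1)) <= 3 * M * (lam ^+ k / mu ^+ i.+1).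
    by apply: rdiff; [rewrite i_ge1 leqnn|rewrite /k0; move: kk1; clear; lia].
  apply; apply: ler_pM.
  - by rewrite mulr_ge0.
  - by rewrite divr_ge0// exprn_ge0// ltW.
  - by rewrite lerDr.
  - rewrite ler_wpM2l// lef_pV2 ?posrE ?exprn_gt0//.
    by rewrite exprS ler_peMl// exprn_ge0// ltW.
- move=> k kk1.
  have i1E : i.-1.+1 = i by rewrite prednK.
  have i1i : (i.-1 <= i)%N by rewrite leq_pred.
  have -> : a i = F i (S i.-1) by have := aE _ i1i (recj _ i1i); rewrite i1E.
  rewrite aE//.
  apply: le_trans (FD i _ _ k _ (Snear _ (leqnn i)) (Snear _ i1i) _) _.
  - by rewrite i_ge1 leqnn.
  - by rewrite /k0; move: kk1; clear; lia.
  have Sdiff m : (m <= k1)%N ->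
      tensor_norm m (S i - S i.-1) <= V * (lam ^+ m / mu ^+ i).
    move=> mk1.
    have -> : S i - S i.-1 =
        remainder_fun (r i.-1) (a i.-1) - remainder_fun (r i) (a i).
      by rewrite /S opprB addrC addrA subrK.
    have Lmui : 0 <= lam ^+ m / mu ^+ i by rewrite divr_ge0// exprn_ge0// ltW.
    have := i_ge1; rewrite leq_eqVlt => /predU1P[i1|i2].
      rewrite -[in r i.-1]i1 -[in a i.-1]i1 a0 remainder_fun0.
      apply: le_trans (tensor_normB _ _ _) _; rewrite tensor_norm0 add0r.
      apply: le_trans (remG i m _ _) _ => //.
        by rewrite /k0; move: mk1; clear; lia.
      by rewrite -i1 expr1 ler_wpM2r// lerDl mulr_ge0.
    have := rdiff i.-1 m; rewrite i1E => /(_ _ _)/le_trans; apply.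
    - by move: i2; clear; lia.
    - by rewrite /k0; move: mk1 i2; clear; lia.
    by rewrite ler_wpM2r// lerDr.
  have Sk : tensor_norm k (S i.-1) + lam ^+ k <= (D + B G) * lam ^+ k.
    have Tk : tensor_norm k T <= (D - 1) * lam ^+ k.
      have [->|] := posnP k.
        by rewrite expr0 mulr1; move: T00 C0; rewrite /D; lra.
      move=> /TB/le_trans; apply.
      apply: ler_pM => //; first exact: ltW.
      by move: t0 c0; rewrite /D; lra.
    have rk : tensor_norm k (remainder_fun (r i.-1) (a i.-1)) <=
        B G * lam ^+ k.
      apply: le_trans (remG i.-1 k i1i _) _.
        by rewrite /k0; move: kk1; clear; lia.
      by rewrite ler_wpM2l.
    have := tensor_normB k T (remainder_fun (r i.-1) (a i.-1)).
    by rewrite -/(S i.-1); move: Tk rk; lra.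
  have d0 := Sdiff 0%N isT; have dk := Sdiff k kk1.
  have muiN0 : mu ^+ i != 0 by rewrite expf_neq0// gt_eqF.
  have -> : Cs * (V + 1 + (D + B G) * (V + 1)) * (lam ^+ k / mu ^+ i) =
    Cs * (V * (lam ^+ k / mu ^+ i) + lam ^+ k / mu ^+ i +
      ((D + B G) * lam ^+ k) * (V * (lam ^+ 0 / mu ^+ i) + 1 / mu ^+ i)).
    by rewrite expr0; ring.
  rewrite ler_wpM2l ?(ltW Cs0)// lerD ?lerD2r//.
  apply: ler_pM => //; rewrite ?lerD2r//.
  - by rewrite addr_ge0// tensor_norm_ge0.
  - by rewrite addr_ge0 ?tensor_norm_ge0// divr_ge0// exprn_ge0// ltW.
Qed.
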